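(* Let $n\ge 2$ be an integer and let $S\subset[n-1]$. Type $C$: \[ |\hat{P}_C(S;n)| = \sum_{k=1}^{n}|P(S;n)^{\nearrow k}|\cdot\Phi(n,k) + |\underline{P(S;n)}|\cdot 2^n \] and \[ |\hat{P}_C(S\cup\{n\};n)| = \sum_{k=1}^{n}|P(S;n)^{\nearrow k}|\cdot\Psi(n,k). \] Type $D$: If $n$ is even, then \[ |\hat{P}_D(S;n)| = \sum_{k=1}^{n/2}\big(|P(S;n)^{\nearrow 2k-1}|+|P(S;n)^{\nearrow 2k}|\big)\,\Phi(n-1,2k-1)+|\underline{P(S;n)}|\,2^{n-1} \] and \[ |\hat{P}_D(S\cup\{n\};n)| = \sum_{k=1}^{n/2}\big(|P(S;n)^{\nearrow 2k-1}|+|P(S;n)^{\nearrow 2k}|\big)\,\Psi(n-1,2k-1). \] If $n$ is odd, then \[ |\hat{P}_D(S;n)| = \sum_{k=1}^{(n-1)/2}\big(|P(S;n)^{\nearrow 2k+1}|+|P(S;n)^{\nearrow 2k}|\big)\,\Phi(n-1,2k)+|\underline{P(S;n)}|\,2^{n-1} \] and \[ |\hat{P}_D(S\cup\{n\};n)| = \sum_{k=1}^{(n-1)/2}\big(|P(S;n)^{\nearrow 2k+1}|+|P(S;n)^{\nearrow 2k}|\big)\,\Psi(n-1,2k). \]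
   Context: Notation: $[n]=\{1,\dots,n\}$; $\subset$ allows equality. $\mathfrak{S}_n$ is the symmetric group on $[n]$, with permutations written in one-line notation $\pi=\pi_1\pi_2\cdots\pi_n$. For a sequence $w_1w_2\cdots w_r$ of distinct integers, an index $i$ with $2\le i\le r-1$ is a peak if $w_{i-1}<w_i>w_{i+1}$, and $P(w_1\cdots w_r)$ denotes the set of all peaks. Set $P(S;n)=\{\pi\in\mathfrak{S}_n \mid P(\pi)=S\}$. For $1\le k\le n$ define $P(S;n)^{\nearrow k}=\{\pi\in P(S;n)\mid \pi_{n-1}<\pi_n \text{ and } \pi_n=k\}$ and $P(S;n)_{\searrow k}=\{\pi\in P(S;n)\mid \pi_{n-1}>\pi_n \text{ and } \pi_n=k\}$, and let $\underline{P(S;n)}=\bigsqcup_{k=1}^n P(S;n)_{\searrow k}$ (the elements of $P(S;n)$ that end with a descent). Mirrored permutations of type $C_n$: $\mathcal{C}_n\subset\mathfrak{S}_{2n}$ is the subgroup of all permutations $\pi_1\cdots\pi_n|\pi_{n+1}\cdots\pi_{2n}\in\mathfrak{S}_{2n}$ (the bar is only a visual separator) such that $\pi_{2n-i+1}=2n-\pi_i+1$ for all $i$. Mirrored permutations of type $D_n$: $\mathcal{D}_n\subset\mathcal{C}_n$ is the subgroup of those $\pi\in\mathcal{C}_n$ for which $\{\pi_1,\dots,\pi_n\}$ contains an even number of elements of $\{n+1,\dots,2n\}$. For $T\subseteq[n]$ define $\hat{P}_C(T;n)=\{\pi\in\mathcal{C}_n\mid P(\pi_1\pi_2\cdots\pi_n\pi_{n+1})=T\}$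 and $\hat{P}_D(T;n)=\{\pi\in\mathcal{D}_n\mid P(\pi_1\pi_2\cdots\pi_n\pi_{n+1})=T\}$ (so a peak at position $n$ is allowed). Binomial sums: $\Phi(n,k)=\sum_{i=k}^{n}\binom{n}{i}$ and $\Psi(n,k)=2^n-\Phi(n,k)$. *)

(* Defs.v *)
From mathcomp Require Import all_boot all_fingroup.
From mathcomp Require Import finmap.

Set Implicit Arguments.
Unset Strict Implicit.
Unset Printing Implicit Defensive.

(* Positions and letters are numbered from 1, so that [n] = {1, ..., n} is a
   set of natural numbers; 'I_m is only used as the carrier of the symmetric
   group, its element i : 'I_m standing for the integer i.+1. *)

Definition interval (n : nat) : {fset nat} := [fset i in iota 1 n]%fset.

(* w_i, for 1 <= i <= size w. *)
Definition letter (w : seq nat) (i : nat) : nat := nth 0 w i.-1.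

Definition peaks (w : seq nat) : {fset nat} :=
  [fset i in iota 2 (size w - 2)
     | (letter w i.-1 < letter w i) && (letter w i.+1 < letter w i)]%fset.

Definition one_line (m : nat) (pi : 'S_m) : seq nat :=
  [seq (pi i).+1 | i <- enum 'I_m].

Section PeakSets.

Variables (S : {fset nat}) (n : nat).

Definition Pset : {set 'S_n} := [set pi : 'S_n | peaks (one_line pi) == S].

Definition Pset_up (k : nat) : {set 'S_n} :=
  [set pi in Pset | (letter (one_line pi) n.-1 < letter (one_line pi) n)
                    && (letter (one_line pi) n == k)].

Definition Pset_down (k : nat) : {set 'S_n} :=
  [set pi in Pset | (letter (one_line pi) n < letter (one_line pi) n.-1)
                    && (letter (one_line pi) n == k)].

Definition Pset_under : {set 'S_n} := \bigcup_(1 <= k < n.+1) Pset_down k.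

End PeakSets.

Definition mirrored_C (n : nat) : {set 'S_(2 * n)} :=
  [set pi : 'S_(2 * n) |
    all (fun i => letter (one_line pi) (2 * n - i + 1)
                  == 2 * n - letter (one_line pi) i + 1)
        (iota 1 (2 * n))].

(* The letters of pi are distinct, so the count below is the cardinality of
   the intersection of {pi_1, ..., pi_n} and {n+1, ..., 2n}. *)
Definition mirrored_D (n : nat) : {set 'S_(2 * n)} :=
  [set pi in mirrored_C n |
    ~~ odd (count (fun x => x \in iota n.+1 n) (take n (one_line pi)))].

Definition PhatC (T : {fset nat}) (n : nat) : {set 'S_(2 * n)} :=
  [set pi in mirrored_C n | peaks (take n.+1 (one_line pi)) == T].

Definition PhatD (T : {fset nat}) (n : nat) : {set 'S_(2 * n)} :=
  [set pi in mirrored_D n | peaks (take n.+1 (one_line pi)) == T].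

Definition Phi (n k : nat) : nat := \sum_(k <= i < n.+1) 'C(n, i).

Lemma Phi_le (n k : nat) : Phi n k <= 2 ^ n.
Proof.
rewrite /Phi -[2]/(1 + 1) expnDn.
under [X in _ <= X]eq_bigr do rewrite !exp1n !muln1.
rewrite -(big_mkord xpredT (fun i => 'C(n, i))).
have [le_kn|lt_nk] := leqP k n.+1; last by rewrite big_geq // ltnW.
by rewrite [X in _ <= X](big_cat_nat (n := k)) //= leq_addl.
Qed.

(* By Phi_le the subtraction is never truncated. *)
Definition Psi (n k : nat) : nat := 2 ^ n - Phi n k.

(* Main.v *)
Require Import Defs.
From mathcomp Require Import all_boot all_fingroup.
From mathcomp Require Import finmap.
From mathcomp Require Import zify.

Set Implicit Arguments.
Unset Strict Implicit.
Unset Printing Implicit Defensive.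

(* Standardizing pi_1 ... pi_n identifies a mirrored permutation pi with a pair
   (s, A), where s : 'S_n and A is the set of letters at most n among
   pi_1, ..., pi_n.  Peaks before position n are those of s.  As
   pi_{n+1} = 2n + 1 - pi_n, there is a peak at n iff s ends with an ascent and
   pi_n > n, i.e. #|A| < s_n.  Counting the sets A by size gives the binomial
   sums; in type D the size is restricted to the parity of n, and Pascal's rule
   turns the sum over every other size into a full sum for n - 1. *)

(** * Letter sets of the first half and their increasing enumeration *)

Section Mirror.

Variable n : nat.

Lemma leq_double_n : n <= 2 * n. Proof. by lia. Qed.

Definition low (j : 'I_n) : 'I_(2 * n) := widen_ord leq_double_n j.

Lemma low_inj : injective low.
Proof. by move=> i j /(congr1 val) /= /val_inj. Qed.

Lemma low_rev (i j : 'I_n) : low i <> rev_ord (low j).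
Proof.
by move=> /(congr1 val) /=; have := ltn_ord i; have := ltn_ord j; lia.
Qed.

Lemma lowP (x : 'I_(2 * n)) :
  (exists j, x = low j) \/ (exists j, x = rev_ord (low j)).
Proof.
have [ltxn|lenx] := ltnP x n.
  by left; exists (Ordinal ltxn); apply: val_inj.
have ltyn : rev_ord x < n by rewrite /=; have := ltn_ord x; lia.
by right; exists (Ordinal ltyn); rewrite -[LHS]rev_ordK; congr rev_ord; apply: val_inj.
Qed.

(* The possible letter sets of pi_1 ... pi_n are the transversals of the pairs
   {j, 2n + 1 - j}, so they are indexed by their sets A of small letters. *)
Definition half_letters (A : {set 'I_n}) : seq 'I_(2 * n) :=
  map low (enum A) ++ map (fun j => rev_ord (low j)) (rev (enum (~: A))).

Lemma size_half_letters A : size (half_letters A) = n.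
Proof.
by rewrite size_cat !size_map size_rev -!cardE cardsC card_ord.
Qed.

Lemma mem_half_low A j : (low j \in half_letters A) = (j \in A).
Proof.
rewrite mem_cat (mem_map low_inj) mem_enum orbC.
by case: mapP => // -[i _ /low_rev].
Qed.

Lemma mem_half_rev A j : (rev_ord (low j) \in half_letters A) = (j \notin A).
Proof.
have inj : injective (fun i : 'I_n => rev_ord (low i)).
  by move=> a b /rev_ord_inj /low_inj.
rewrite mem_cat (mem_map inj).
rewrite mem_rev mem_enum inE.
by case: mapP => // -[i _ /esym /low_rev].
Qed.

Lemma enum_pairwise_ltn (A : {set 'I_n}) :
  pairwise (fun i j : 'I_n => i < j) (enum A).
Proof.
rewrite /enum_mem; apply: pairwise_filter; rewrite -enumT.
rewrite -(pairwise_map val ltn) val_enum_ord -sorted_pairwise ?iota_ltn_sorted //.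
exact: ltn_trans.
Qed.

(** Within the second block both [rev] and [rev_ord] reverse the order, so the block increases; it
    lies entirely above [n], after the small letters. *)
Lemma half_letters_pairwise A :
  pairwise (fun x y : 'I_(2 * n) => x < y) (half_letters A).
Proof.
rewrite pairwise_cat !pairwise_map; apply/and3P; split.
- apply/allrelP => x y /mapP[i _ ->] /mapP[j _ ->] /=.
  by have := ltn_ord i; have := ltn_ord j; lia.
- exact: enum_pairwise_ltn.
have := enum_pairwise_ltn (~: A); elim: (enum _) => //= i s IHs /andP[lt_is /IHs].
rewrite rev_cons -cats1 pairwise_cat /= andbT => ->; rewrite andbT.
apply/allrelP => x y; rewrite mem_rev inE => xs /eqP-> /=.
by have := allP lt_is x xs; have := ltn_ord i; have := ltn_ord x; lia.
Qed.

(** The inverse of standardization: the increasing map from 0-based ranks to letters of the first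
    half. *)
Definition kth_letter A (j : 'I_n) : 'I_(2 * n) := nth (low j) (half_letters A) j.

Lemma kth_letter_lt A (i j : 'I_n) : i < j -> kth_letter A i < kth_letter A j.
Proof.
move=> lt_ij; rewrite /kth_letter (set_nth_default (low i) (low j)) ?size_half_letters //.
have /(pairwiseP (low i)) := half_letters_pairwise A.
by apply=> //; rewrite inE size_half_letters.
Qed.

Lemma kth_letter_ltE A (i j : 'I_n) : (kth_letter A i < kth_letter A j) = (i < j).
Proof.
case: (ltngtP i j) => [/kth_letter_lt-> //|/(kth_letter_lt A)|/val_inj->].
  by rewrite ltnNge => /negbTE; lia.
by rewrite ltnn.
Qed.

Lemma kth_letter_inj A : injective (kth_letter A).
Proof.
move=> i j eq_ij; apply: val_inj.
by case: (ltngtP i j) => [||//] /(kth_letter_lt A); rewrite eq_ij ltnn.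
Qed.

Lemma mem_kth_letter A j : kth_letter A j \in half_letters A.
Proof. by rewrite mem_nth ?size_half_letters. Qed.

(** The first [#|A|] entries of the increasing list are its small letters. *)
Lemma kth_letter_small A j : (kth_letter A j < n) = (j < #|A|).
Proof.
rewrite /kth_letter /half_letters nth_cat size_map -cardE.
case: ifP => ltjA; first by rewrite (nth_map j) -?cardE //= ltn_ord.
have ltj : j - #|A| < size (rev (enum (~: A))).
  rewrite size_rev -cardE ltn_subLR ?cardsC ?card_ord ?ltn_ord //.
  by rewrite leqNgt ltjA.
by rewrite (nth_map j) //=; set k := nth _ _ _; have := ltn_ord k; lia.
Qed.

Lemma half_lettersP A x :
  reflect (exists j, x = kth_letter A j) (x \in half_letters A).
Proof.
apply: (iffP idP) => [xA|[j ->]]; last exact: mem_kth_letter.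
have lt_xn : index x (half_letters A) < n.
  by rewrite -[X in _ < X](size_half_letters A) index_mem.
by exists (Ordinal lt_xn); rewrite /kth_letter nth_index.
Qed.

(** The transversal property. It keeps the values on the two halves of a mirrored permutation apart,
    which makes [mirror_fun] injective. *)
Lemma half_letters_rev A x :
  (rev_ord x \in half_letters A) = (x \notin half_letters A).
Proof.
case: (lowP x) => -[j ->]; first by rewrite mem_half_rev mem_half_low.
by rewrite rev_ordK mem_half_rev mem_half_low negbK.
Qed.

(** * The bijection between pairs and mirrored permutations *)

Definition mirror_fun (s : 'S_n) A (x : 'I_(2 * n)) : 'I_(2 * n) :=
  if insub (val x) is Some j then kth_letter A (s j)
  else if insub (val (rev_ord x)) is Some j then rev_ord (kth_letter A (s j))
  else x.

Lemma mirror_fun_low s A j : mirror_fun s A (low j) = kth_letter A (s j).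
Proof. by rewrite /mirror_fun /= valK. Qed.

Lemma mirror_fun_rev_low s A j :
  mirror_fun s A (rev_ord (low j)) = rev_ord (kth_letter A (s j)).
Proof.
rewrite /mirror_fun rev_ordK valK insubF //=.
by have := ltn_ord j; lia.
Qed.

Lemma mirror_fun_inj s A : injective (mirror_fun s A).
Proof.
move=> x y; case: (lowP x) => -[i ->]; case: (lowP y) => -[j ->];
  rewrite ?mirror_fun_low ?mirror_fun_rev_low.
- by move=> /kth_letter_inj /perm_inj ->.
- move=> eq_ij; have := mem_kth_letter A (s i).
  by rewrite eq_ij half_letters_rev mem_kth_letter.
- move=> eq_ij; have := mem_kth_letter A (s j).
  by rewrite -eq_ij half_letters_rev mem_kth_letter.
by move=> /rev_ord_inj /kth_letter_inj /perm_inj ->.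
Qed.

Definition mirror_perm (sA : 'S_n * {set 'I_n}) : 'S_(2 * n) :=
  perm (@mirror_fun_inj sA.1 sA.2).

Lemma mirror_perm_low s A j : mirror_perm (s, A) (low j) = kth_letter A (s j).
Proof. by rewrite permE mirror_fun_low. Qed.

Lemma mirror_perm_rev sA x :
  mirror_perm sA (rev_ord x) = rev_ord (mirror_perm sA x).
Proof.
rewrite !permE; case: (lowP x) => -[j ->].
  by rewrite mirror_fun_low mirror_fun_rev_low.
by rewrite rev_ordK mirror_fun_low mirror_fun_rev_low rev_ordK.
Qed.

(** The first [n] values determine the letter set, hence [A]; once [A] is known, injectivity of
    [kth_letter A] gives back [s]. *)
Lemma mirror_perm_inj : injective mirror_perm.
Proof.
move=> [s A] [t B] eq_st.
have eq_kth j : kth_letter A (s j) = kth_letter B (t j).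
  by rewrite -!mirror_perm_low eq_st.
suff eqAB : A = B.
  rewrite -{}eqAB in eq_kth *; congr (_, _).
  by apply/permP => j; apply: (kth_letter_inj (eq_kth j)).
apply/setP => a; rewrite -!mem_half_low; apply/half_lettersP/half_lettersP => -[j ->].
  by exists (t (s^-1 j)%g); rewrite -eq_kth permKV.
by exists (s (t^-1 j)%g); rewrite eq_kth permKV.
Qed.

Lemma letter_one_line m (p : 'S_m) (i : 'I_m) : letter (one_line p) i.+1 = (p i).+1.
Proof. by rewrite /letter /one_line (nth_map i) ?size_enum_ord //= nth_ord_enum. Qed.

(** On 0-based indices the reflection of [i] to [2 * n - i + 1] is [rev_ord], for positions and
    letters alike. *)
Lemma mirrored_CP (p : 'S_(2 * n)) :
  reflect (forall x, p (rev_ord x) = rev_ord (p x)) (p \in mirrored_C n).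
Proof.
rewrite inE; apply: (iffP allP) => [mir_p x|mir_p i].
  apply: val_inj; have /= := mir_p x.+1.
  rewrite mem_iota letter_one_line.
  have -> : 2 * n - x.+1 + 1 = (rev_ord x).+1 by rewrite /= ; lia.
  rewrite letter_one_line => /(_ _)/eqP; have := ltn_ord x; have := ltn_ord (p x).
  by lia.
rewrite mem_iota; case: i => // i /andP[_ lt_i].
have {}lt_i : i < 2 * n by lia.
have -> : 2 * n - i.+1 + 1 = (rev_ord (Ordinal lt_i)).+1 by rewrite /=; lia.
rewrite (letter_one_line _ (Ordinal lt_i)) letter_one_line mir_p /=.
by have := ltn_ord (p (Ordinal lt_i)); lia.
Qed.

Lemma mirror_perm_onto p : p \in mirrored_C n -> exists sA, p = mirror_perm sA.
Proof.
move=> /mirrored_CP mir_p.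
(* [A] collects the small letters of the first half. If a letter and its mirror image both occurred
   there, [p] would agree at a low position and at a mirrored one. *)
pose A := [set a | [exists j, p (low j) == low a]].
have pA j : p (low j) \in half_letters A.
  case: (lowP (p (low j))) => -[a pj]; rewrite pj.
    by rewrite mem_half_low inE; apply/existsP; exists j; rewrite pj.
  rewrite mem_half_rev inE; apply/negP => /existsP[i /eqP pi].
  by move: pj; rewrite -pi -mir_p => /perm_inj /low_rev.
have kthP j : exists k, p (low j) == kth_letter A k.
  by have /half_lettersP[k ->] := pA j; exists k.
(* The rank of the letter at position [j]; these ranks form the standardization of the first
   half. *)
pose t j := xchoose (kthP j).
have tE j : p (low j) = kth_letter A (t j) by apply/eqP/(xchooseP (kthP j)).
have t_inj : injective t.
  by move=> i j eq_t; apply/low_inj/(@perm_inj _ p); rewrite !tE eq_t.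
exists (perm t_inj, A); apply/permP => x.
by case: (lowP x) => -[j ->]; rewrite ?mir_p ?mirror_perm_rev mirror_perm_low permE -tE.
Qed.

Lemma mirror_perm_in sA : mirror_perm sA \in mirrored_C n.
Proof. by apply/mirrored_CP => x; rewrite mirror_perm_rev. Qed.

(** * Comparisons, peaks and cardinalities in terms of pairs *)

Lemma size_one_line m (p : 'S_m) : size (one_line p) = m.
Proof. by rewrite size_map size_enum_ord. Qed.

Lemma letter_mirror_low s A (j : 'I_n) :
  letter (one_line (mirror_perm (s, A))) j.+1 = (kth_letter A (s j)).+1.
Proof. by rewrite (letter_one_line _ (low j)) mirror_perm_low. Qed.

Lemma letter_mirror_ltE s A a b : 0 < a <= n -> 0 < b <= n ->
  (letter (one_line (mirror_perm (s, A))) a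
     < letter (one_line (mirror_perm (s, A))) b)
  = (letter (one_line s) a < letter (one_line s) b).
Proof.
case: a => // i lt_i; case: b => // j lt_j.
rewrite !(letter_mirror_low _ _ (Ordinal lt_i), letter_mirror_low _ _ (Ordinal lt_j)).
rewrite (letter_one_line _ (Ordinal lt_i)) (letter_one_line _ (Ordinal lt_j)).
exact: kth_letter_ltE.
Qed.

(** The letters at [n] and [n.+1] are mirror images, so the first is larger iff it exceeds [n], that
    is, iff its 0-based rank is at least [#|A|]. Passing to the 1-based letter of [s] makes the
    inequality strict. *)
Lemma letter_mirror_mid s A : 0 < n ->
  (letter (one_line (mirror_perm (s, A))) n.+1
     < letter (one_line (mirror_perm (s, A))) n)
  = (#|A| < letter (one_line s) n).
Proof.
move=> n_gt0; have ltj : n.-1 < n by rewrite prednK.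
pose j := Ordinal ltj.
have letn m (p : 'S_m) : letter (one_line p) n = letter (one_line p) j.+1.
  by rewrite /= prednK.
rewrite !letn letter_mirror_low letter_one_line.
have -> : n.+1 = (rev_ord (low j)).+1 by rewrite /=; lia.
rewrite letter_one_line mirror_perm_rev mirror_perm_low /= !ltnS.
rewrite [RHS]leqNgt -kth_letter_small.
by have := ltn_ord (kth_letter A (s j)); lia.
Qed.

Lemma letter_take k w i : 0 < i <= k -> letter (take k w) i = letter w i.
Proof. by case: i => // i lt_ik; rewrite /letter nth_take. Qed.

Definition final_ascent m (s : 'S_m) : bool :=
  letter (one_line s) m.-1 < letter (one_line s) m.

Lemma peaks_mirror s A i : 1 < n ->
  (i \in peaks (take n.+1 (one_line (mirror_perm (s, A)))))
  = if i == n then final_ascent s && (#|A| < letter (one_line s) n)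
    else i \in peaks (one_line s).
Proof.
move=> n_gt1; rewrite !inE /= !mem_iota size_takel ?size_one_line; last by lia.
have [->|neq_in] := eqVneq i n.
  rewrite !letter_take ?letter_mirror_mid ?letter_mirror_ltE; try by lia.
  by have -> : 1 < n < 2 + (n.+1 - 2) by lia.
(* The extra letter adds only the index [n] to the admissible range; any other peak compares letters
   of the first half, whose relative order is that of [s]. *)
have -> : 1 < i < 2 + (n.+1 - 2) = (1 < i < 2 + (n - 2)) by lia.
case: (boolP (1 < i < _)) => //= lt_i.
by rewrite !letter_take ?letter_mirror_ltE //; lia.
Qed.

Lemma count_leq_iota a m : count (leq a) (iota 0 m) = m - a.
Proof.
elim: m => // m IHm.
by rewrite -addn1 iotaD count_cat IHm /= add0n addn0; case: (leqP a m); lia.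
Qed.

(** The large letters have the ranks from [#|A|] on, and [s] merely permutes ranks. This makes the
    type D condition one on the size of [A] alone. *)
Lemma count_large_letters s A :
  count (fun x => x \in iota n.+1 n) (take n (one_line (mirror_perm (s, A))))
  = n - #|A|.
Proof.
have -> : take n (one_line (mirror_perm (s, A)))
          = [seq (kth_letter A (s j)).+1 | j <- enum 'I_n].
  apply: (@eq_from_nth _ 0) => [|i].
    by rewrite size_takel ?size_one_line ?leq_double_n // size_map size_enum_ord.
  rewrite size_takel ?size_one_line ?leq_double_n // => lt_in.
  rewrite nth_take // -[nth _ _ _]/(letter _ (Ordinal lt_in).+1).
  rewrite letter_mirror_low (nth_map (Ordinal lt_in)) ?size_enum_ord //.
  by rewrite (nth_ord_enum _ (Ordinal lt_in)).
rewrite count_map -(count_leq_iota #|A| n) -val_enum_ord count_map.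
rewrite -!sum1_count !big_enum_cond [RHS](reindex_inj (@perm_inj _ s)) /=.
apply: eq_bigl => j; rewrite mem_iota [RHS]leqNgt -(kth_letter_small A).
by have := ltn_ord (kth_letter A (s j)); lia.
Qed.

(** Carries a count across the bijection [mirror_perm], leaving for each [s] a count of admissible
    sets [A]. *)
Lemma card_mirrored_C (Q : pred 'S_(2 * n)) (R : 'S_n -> pred {set 'I_n}) :
    (forall s A, Q (mirror_perm (s, A)) = R s A) ->
  #|[set p in mirrored_C n | Q p]| = \sum_s #|[set A | R s A]|.
Proof.
move=> QR.
have -> : [set p in mirrored_C n | Q p]
          = mirror_perm @: [set sA | R sA.1 sA.2].
  apply/setP=> p; apply/setIdP/imsetP => [[/mirror_perm_onto[[s A] ->]]|].
    by rewrite QR => RsA; exists (s, A); rewrite ?inE.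
  by case=> -[s A]; rewrite inE => RsA ->; rewrite mirror_perm_in QR.
rewrite card_imset; last exact: mirror_perm_inj.
rewrite -sum1_card (eq_bigl (fun sA => xpredT sA.1 && R sA.1 sA.2)).
  rewrite -(pair_big_dep xpredT R (fun _ _ => 1)) /=; apply: eq_bigr => s _.
  by rewrite -sum1_card; apply: eq_bigl => A; rewrite inE.
by move=> sA; rewrite inE.
Qed.

End Mirror.

(** * Counting by fibers and by subset size *)

Lemma sum_fiber (T : finType) (P : pred T) (f : T -> nat) (F : nat -> nat) a b :
    (forall x, P x -> a <= f x < b) ->
  \sum_(x | P x) F (f x) = \sum_(a <= k < b) #|[set x | P x & f x == k]| * F k.
Proof.
move=> f_ab.
under [RHS]eq_bigr => k _.
  rewrite -sum1_card big_distrl /= (eq_bigl (fun x => P x && (f x == k))).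
    rewrite big_mkcondr /=; over.
  by move=> x; rewrite inE.
rewrite exchange_big /=; apply: eq_bigr => x /f_ab f_x.
rewrite -big_mkcond /= (eq_bigl (fun k => k == f x)) => [|k]; last by rewrite eq_sym.
by rewrite big_nat1_eq f_x mul1n.
Qed.

Lemma card_subsets_size (n : nat) (Q : pred nat) :
  #|[set A : {set 'I_n} | Q #|A|]| = \sum_(0 <= i < n.+1 | Q i) 'C(n, i).
Proof.
rewrite -sum1_card [LHS](eq_bigl (fun A : {set 'I_n} => Q #|A|)); last first.
  by move=> A; rewrite inE.
rewrite big_mkcond /=.
rewrite (@sum_fiber _ xpredT (fun A : {set 'I_n} => #|A|)
           (fun i => if Q i then 1 else 0) 0 n.+1); last first.
  by move=> A _; rewrite leq0n ltnS (leq_trans (max_card _)) ?card_ord.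
rewrite [RHS]big_mkcond; apply: eq_bigr => i _.
by case: (Q i); rewrite ?muln0 // muln1 /= card_draws card_ord.
Qed.

Lemma Phi0 m : Phi m 0 = 2 ^ m.
Proof.
rewrite /Phi big_mkord -[2]/(1 + 1) expnDn; apply: eq_bigr => i _.
by rewrite !exp1n !muln1.
Qed.

Lemma Phi_recl m k : k <= m -> Phi m k = 'C(m, k) + Phi m k.+1.
Proof. by move=> le_km; rewrite /Phi big_ltn. Qed.

(** * Binomial sums over sizes of a prescribed parity *)

Section SubsetSums.

Variable n : nat.

(** [W] selects the admissible sizes: all of them in type C, those of the parity of [n] in type
    D. *)
Definition subsets_from (W : pred nat) k :=
  \sum_(0 <= i < n.+1 | W i && (k <= i)) 'C(n, i).

Definition subsets_below (W : pred nat) k :=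
  \sum_(0 <= i < n.+1 | W i && (i < k)) 'C(n, i).

Lemma subsets_from0 W k : subsets_from W 0 = subsets_from W k + subsets_below W k.
Proof.
rewrite /subsets_from (bigID (leq k)) /=; congr (_ + _); apply: eq_bigl => i;
  by rewrite ?leq0n ?andbT // -ltnNge.
Qed.

Lemma subsets_from_all k : subsets_from xpredT k = Phi n k.
Proof.
rewrite /subsets_from /Phi /=; apply/esym.
have [le_kn|lt_nk] := leqP k n.+1; last first.
  rewrite big_geq ?(ltnW lt_nk) // big_nat_cond big_pred0 // => i.
  by lia.
by rewrite (big_nat_widenl _ 0).
Qed.

Lemma subsets_below_all k : subsets_below xpredT k = Psi n k.
Proof.
by rewrite /Psi -Phi0 -!subsets_from_all (subsets_from0 _ k) addKn.
Qed.

Lemma subsets_from_recl W k : k <= n ->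
  subsets_from W k = (if W k then 'C(n, k) else 0) + subsets_from W k.+1.
Proof.
move=> le_kn; rewrite /subsets_from (bigID (pred1 k)) /=; congr (_ + _).
  by rewrite big_nat1_cond_eq leqnn ltnS le_kn !andbT.
by apply: eq_bigl => i; rewrite [k < i]ltn_neqAle [k == i]eq_sym -andbA [(i != k) && _]andbC.
Qed.

Hypothesis n_gt0 : 0 < n.

(** Two sizes are split off at a time: [k] contributes 'C(n, k) = 'C(n-1, k-1) + 'C(n-1, k) by
    Pascal's rule, and [k.+1] contributes nothing. At [k = 0] the predecessor truncates, and 'C(n,
    0) supplies the single term 'C(n-1, 0). *)
Lemma subsets_from_even k : k <= n -> ~~ odd (n - k) ->
  subsets_from (fun i => ~~ odd (n - i)) k = Phi n.-1 k.-1.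
Proof.
set W := fun i => _; have [d le_d] := ubnP (n - k); elim: d => // d IHd in k le_d *.
move=> le_kn even_k; have [lt_kn|le_nk] := ltnP k n; last first.
  have -> : k = n by lia.
  rewrite subsets_from_recl // /W subnn /= binn /subsets_from big_nat_cond big_pred0.
    by rewrite [RHS]Phi_recl // binn /Phi big_geq.
  by move=> i; lia.
have lt_k1n : k.+1 < n.
  by move: even_k; lia.
rewrite subsets_from_recl // subsets_from_recl // /W even_k.
have -> : odd (n - k.+1) by move: even_k; lia.
rewrite IHd ?add0n //; [|lia..].
case: k {IHd le_d even_k lt_kn} lt_k1n le_kn => [|k] lt_kn _.
  by rewrite bin0 [RHS]Phi_recl // bin0.
rewrite [in RHS]Phi_recl /=; last by lia.
rewrite [in RHS]Phi_recl; last by lia.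
by rewrite addnA -{1}(prednK n_gt0) binS [_ + 'C(_, k)]addnC.
Qed.

(** When [n - k] is odd, the size [k] is itself excluded and the threshold rises to [k.+1]. *)
Lemma subsets_from_parity k : k <= n ->
  subsets_from (fun i => ~~ odd (n - i)) k = Phi n.-1 (k + odd (n - k)).-1.
Proof.
move=> le_kn; case: (boolP (odd (n - k))) => [odd_k|even_k]; last first.
  by rewrite addn0 subsets_from_even.
have lt_kn : k < n by case: ltnP odd_k => //; rewrite -subn_eq0 => /eqP->.
rewrite subsets_from_recl // odd_k add0n addn1 subsets_from_even //.
by rewrite subnS -subn1 oddB ?subn_gt0 // odd_k.
Qed.

Lemma subsets_below_parity k : k <= n ->
  subsets_below (fun i => ~~ odd (n - i)) k = Psi n.-1 (k + odd (n - k)).-1.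
Proof.
move=> le_kn; rewrite /Psi -subsets_from_parity // -Phi0.
(* For either parity of [n] the threshold 0 yields index 0, as 0 and 1 have the same predecessor;
   the total is thus 2^(n-1). *)
have -> : 0 = (0 + odd (n - 0)).-1 by case: (odd _).
by rewrite -subsets_from_parity // (subsets_from0 _ k) addKn.
Qed.

End SubsetSums.

(** * Counts expressed through the peak sets of the symmetric group *)

Section PeakCount.

Variables (n : nat) (S : {fset nat}).
Hypotheses (n_gt1 : 1 < n) (sub_S : (S `<=` interval n.-1)%fset).

Lemma mid_notin_S : n \notin S.
Proof.
by apply/negP => /(fsubsetP sub_S); rewrite !inE /= mem_iota; lia.
Qed.

Lemma mid_notin_peaks (s : 'S_n) : n \notin peaks (one_line s).
Proof. by rewrite !inE /= mem_iota size_one_line; lia. Qed.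

(** Since [n] lies neither in [S] nor in [peaks (one_line s)], index [n] isolates the midpoint
    condition and the other indices compare [peaks (one_line s)] with [S]. *)
Lemma peaks_mirror_eq s (A : {set 'I_n}) :
  (peaks (take n.+1 (one_line (mirror_perm (s, A)))) == S)
  = (peaks (one_line s) == S)
    && ~~ (final_ascent s && (#|A| < letter (one_line s) n)).
Proof.
apply/eqP/andP => [eqS|[/eqP eqS nasc]].
  split; last first.
    have := peaks_mirror s A n n_gt1.
    by rewrite eqxx eqS (negbTE mid_notin_S) => <-.
  apply/eqP/fsetP => i; rewrite -eqS peaks_mirror //.
  case: eqP => // ->; rewrite (negbTE (mid_notin_peaks s)).
  have := peaks_mirror s A n n_gt1.
  by rewrite eqxx eqS (negbTE mid_notin_S) => <-.
apply/fsetP => i; rewrite peaks_mirror // eqS.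
by case: eqP => // ->; rewrite (negbTE nasc) (negbTE mid_notin_S).
Qed.

Lemma peaks_mirror_eqU s (A : {set 'I_n}) :
  (peaks (take n.+1 (one_line (mirror_perm (s, A)))) == S `|` [fset n])%fset
  = (peaks (one_line s) == S)
    && (final_ascent s && (#|A| < letter (one_line s) n)).
Proof.
apply/eqP/andP => [eqS|[/eqP eqS asc]].
  split; last first.
    have := peaks_mirror s A n n_gt1.
    by rewrite eqxx eqS in_fsetU in_fset1 eqxx orbT => <-.
  apply/eqP/fsetP => i; have := peaks_mirror s A i n_gt1; rewrite eqS in_fsetU in_fset1.
  case: eqP => [-> _|_ <-]; last by rewrite orbF.
  by rewrite (negbTE (mid_notin_peaks s)) (negbTE mid_notin_S).
apply/fsetP => i; rewrite peaks_mirror // eqS in_fsetU in_fset1 asc.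
by case: eqP; rewrite ?orbT ?orbF.
Qed.

Lemma letter_last_bounds (s : 'S_n) : 1 <= letter (one_line s) n < n.+1.
Proof.
have ltn : n.-1 < n by lia.
have -> : letter (one_line s) n = letter (one_line s) (Ordinal ltn).+1.
  by rewrite /= prednK //; lia.
by rewrite letter_one_line /= ltnS.
Qed.

Lemma final_descent (s : 'S_n) :
  (letter (one_line s) n < letter (one_line s) n.-1) = ~~ final_ascent s.
Proof.
rewrite /final_ascent -leqNgt ltn_neqAle; apply: andb_idl => _.
have lt1 : n.-1 < n by lia.
have lt2 : n.-2 < n by lia.
have -> : letter (one_line s) n = letter (one_line s) (Ordinal lt1).+1.
  by rewrite /= prednK //; lia.
have -> : letter (one_line s) n.-1 = letter (one_line s) (Ordinal lt2).+1.
  by rewrite /= prednK //; lia.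
rewrite !letter_one_line eqSS; apply/eqP => /val_inj/perm_inj/(congr1 val) /=.
by lia.
Qed.

Lemma Pset_underE : Pset_under S n = [set s in Pset S n | ~~ final_ascent s].
Proof.
apply/setP => s; rewrite /Pset_under.
(* Membership turns the union into a disjunction over [k], witnessed by the last letter of [s]. *)
rewrite (big_morph (fun B : {set 'S_n} => s \in B) (in_setU s) (in_set0 s)) big_has.
apply/hasP/setIdP => [[k _]|[Ss desc]].
  by rewrite !inE final_descent => /and3P[].
exists (letter (one_line s) n); first by rewrite mem_index_iota letter_last_bounds.
by rewrite inE Ss final_descent desc eqxx.
Qed.

Lemma sum_final_ascent (F : nat -> nat) :
  \sum_(s in Pset S n | final_ascent s) F (letter (one_line s) n)
  = \sum_(1 <= k < n.+1) #|Pset_up S n k| * F k.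
Proof.
rewrite (@sum_fiber _ _ _ F 1 n.+1) => [|s _]; last exact: letter_last_bounds.
by apply: eq_bigr => k _; congr (_ * _); apply: eq_card => s; rewrite !inE andbA.
Qed.

(** A final ascent to [k] forces [k <= #|A|], while a final descent leaves [A] free, whence the
    threshold 0 in the second term. *)
Lemma sum_no_peak_mid W :
  \sum_(s : 'S_n) #|[set A : {set 'I_n} |
      (peaks (one_line s) == S)
      && ~~ (final_ascent s && (#|A| < letter (one_line s) n)) && W #|A|]|
  = \sum_(1 <= k < n.+1) #|Pset_up S n k| * subsets_from n W k
    + #|Pset_under S n| * subsets_from n W 0.
Proof.
rewrite -sum_final_ascent Pset_underE -sum_nat_const (bigID (mem (Pset S n))) /=.
rewrite [X in _ + X]big1 ?addn0 => [|s]; last first.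
  by rewrite inE => /negbTE ->; apply: eq_card0 => A; rewrite inE.
rewrite (bigID (@final_ascent n)) /=; congr (_ + _).
  apply: eq_bigr => s; rewrite inE => /andP[-> ->].
  rewrite -[RHS]card_subsets_size; apply: eq_card => A.
  by rewrite !inE /= -leqNgt andbC.
apply: eq_big => s; first by rewrite !inE.
rewrite inE => /andP[-> /negbTE ->].
rewrite -[RHS]card_subsets_size; apply: eq_card => A.
by rewrite !inE /= andbT.
Qed.

Lemma sum_peak_mid W :
  \sum_(s : 'S_n) #|[set A : {set 'I_n} |
      (peaks (one_line s) == S)
      && (final_ascent s && (#|A| < letter (one_line s) n)) && W #|A|]|
  = \sum_(1 <= k < n.+1) #|Pset_up S n k| * subsets_below n W k.
Proof.
rewrite -sum_final_ascent [RHS]big_mkcond; apply: eq_bigr => s _ /=.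
rewrite inE; case: ifP => [/andP[-> ->]|nSs].
  by rewrite -[RHS]card_subsets_size; apply: eq_card => A; rewrite !inE /= andbC.
by apply: eq_card0 => A; rewrite inE andbA nSs.
Qed.

Lemma card_PhatC :
  #|PhatC S n|
    = \sum_(1 <= k < n.+1) #|Pset_up S n k| * subsets_from n xpredT k
      + #|Pset_under S n| * subsets_from n xpredT 0
  /\ #|PhatC (S `|` [fset n])%fset n|
    = \sum_(1 <= k < n.+1) #|Pset_up S n k| * subsets_below n xpredT k.
Proof.
rewrite -sum_no_peak_mid -sum_peak_mid; split; apply: card_mirrored_C => s A.
  by rewrite peaks_mirror_eq andbT.
by rewrite peaks_mirror_eqU andbT.
Qed.

(** [W] is the type D condition, by [count_large_letters]. *)
Lemma card_PhatD (W := fun i => ~~ odd (n - i)) :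
  #|PhatD S n|
    = \sum_(1 <= k < n.+1) #|Pset_up S n k| * subsets_from n W k
      + #|Pset_under S n| * subsets_from n W 0
  /\ #|PhatD (S `|` [fset n])%fset n|
    = \sum_(1 <= k < n.+1) #|Pset_up S n k| * subsets_below n W k.
Proof.
have PhatDE T : PhatD T n = [set p in mirrored_C n |
    (peaks (take n.+1 (one_line p)) == T)
    && ~~ odd (count (fun x => x \in iota n.+1 n) (take n (one_line p)))].
  by apply/setP => p; rewrite !inE -andbA [X in _ && X]andbC.
rewrite -sum_no_peak_mid -sum_peak_mid !PhatDE.
split; apply: card_mirrored_C => s A; rewrite count_large_letters.
  by rewrite peaks_mirror_eq.
by rewrite peaks_mirror_eqU.
Qed.

(** No letter lies below 1. This removes the index left over when the sum for odd [n] is paired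
    off. *)
Lemma Pset_up1 : #|Pset_up S n 1| = 0.
Proof.
apply: eq_card0 => s; rewrite !inE; apply/negP => /and3P[_ + /eqP s_n].
have ltn : n.-2 < n by lia.
have -> : letter (one_line s) n.-1 = letter (one_line s) (Ordinal ltn).+1.
  by rewrite /= prednK //; lia.
by rewrite s_n letter_one_line.
Qed.

End PeakCount.

(** * Pairing consecutive last letters *)

Lemma sum_pairs (F : nat -> nat) m :
  \sum_(1 <= k < (2 * m).+1) F k = \sum_(1 <= k < m.+1) (F (2 * k - 1) + F (2 * k)).
Proof.
elim: m => [|m IHm]; first by rewrite !big_geq.
rewrite [RHS]big_nat_recr //= -IHm (_ : 2 * m.+1 = (2 * m).+2); last by lia.
by rewrite big_nat_recr // big_nat_recr //= subn1 addnA.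
Qed.

Lemma sum_pairs_shift (F : nat -> nat) m :
  \sum_(1 <= k < (2 * m).+2) F k
  = F 1 + \sum_(1 <= k < m.+1) (F (2 * k + 1) + F (2 * k)).
Proof.
rewrite big_ltn // big_add1 /= sum_pairs; congr (_ + _).
apply: eq_big_nat => k /andP[k_gt0 _]; rewrite addnC addn1.
by congr (_ + F _); lia.
Qed.

Theorem theorem26 (n : nat) (S : {fset nat})
  (n_ge2 : 2 <= n) (sub_S : (S `<=` interval n.-1)%fset) :
  [/\ (* type C *)
      #|PhatC S n|
        = \sum_(1 <= k < n.+1) #|Pset_up S n k| * Phi n k
          + #|Pset_under S n| * 2 ^ n
      /\
      #|PhatC (S `|` [fset n])%fset n|
        = \sum_(1 <= k < n.+1) #|Pset_up S n k| * Psi n k,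
      (* type D, n even *)
      ~~ odd n ->
      #|PhatD S n|
        = \sum_(1 <= k < (n %/ 2).+1)
             (#|Pset_up S n (2 * k - 1)| + #|Pset_up S n (2 * k)|)
               * Phi (n - 1) (2 * k - 1)
          + #|Pset_under S n| * 2 ^ (n - 1)
      /\
      #|PhatD (S `|` [fset n])%fset n|
        = \sum_(1 <= k < (n %/ 2).+1)
             (#|Pset_up S n (2 * k - 1)| + #|Pset_up S n (2 * k)|)
               * Psi (n - 1) (2 * k - 1)
    & (* type D, n odd *)
      odd n ->
      #|PhatD S n|
        = \sum_(1 <= k < ((n - 1) %/ 2).+1)
             (#|Pset_up S n (2 * k + 1)| + #|Pset_up S n (2 * k)|)
               * Phi (n - 1) (2 * k)
          + #|Pset_under S n| * 2 ^ (n - 1)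
      /\
      #|PhatD (S `|` [fset n])%fset n|
        = \sum_(1 <= k < ((n - 1) %/ 2).+1)
             (#|Pset_up S n (2 * k + 1)| + #|Pset_up S n (2 * k)|)
               * Psi (n - 1) (2 * k)].
Proof.
have n_gt0 : 0 < n by apply: ltnW.
have [[C1 C2] [D1 D2]] := (card_PhatC n_ge2 sub_S, card_PhatD n_ge2 sub_S).
have D0 : subsets_from n (fun i => ~~ odd (n - i)) 0 = 2 ^ (n - 1).
  rewrite subsets_from_parity // subn1 -Phi0; congr Phi.
  by case: (odd _).
split=> [|even_n|odd_n].
- split; rewrite ?C1 ?C2 ?subsets_from_all ?Phi0; first congr (_ + _);
    by apply: eq_bigr => k _; rewrite ?subsets_from_all ?subsets_below_all.
- have nE : n = 2 * (n %/ 2) by move: even_n; lia.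
  have pairs F : \sum_(1 <= k < n.+1) F k
      = \sum_(1 <= k < (n %/ 2).+1) (F (2 * k - 1) + F (2 * k)).
    by rewrite -sum_pairs -nE.
  (* For even [n] the threshold [2 * k - 1] has the wrong parity and rises to [2 * k], so both
     members of a pair share one coefficient. *)
  have parity k : 1 <= k < (n %/ 2).+1 ->
      [/\ 2 * k - 1 <= n, 2 * k <= n,
          (2 * k - 1 + odd (n - (2 * k - 1))).-1 = 2 * k - 1
        & (2 * k + odd (n - 2 * k)).-1 = 2 * k - 1].
    by move: even_n; split; lia.
  rewrite D1 D2 D0 !pairs; split; first congr (_ + _);
    apply: eq_big_nat => k /parity[le1 le2 k1 k2];
    by rewrite ?subsets_from_parity ?subsets_below_parity // k1 k2 (subn1 n) mulnDl.
- have nE : n = (2 * ((n - 1) %/ 2)).+1 by move: odd_n; lia.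
  have pairs F : \sum_(1 <= k < n.+1) F k
      = F 1 + \sum_(1 <= k < ((n - 1) %/ 2).+1) (F (2 * k + 1) + F (2 * k)).
    by rewrite -sum_pairs_shift -nE.
  (* For odd [n] it is [2 * k] that rises, to [2 * k + 1], so the pairs start at 2. *)
  have parity k : 1 <= k < ((n - 1) %/ 2).+1 ->
      [/\ 2 * k + 1 <= n, 2 * k <= n,
          (2 * k + 1 + odd (n - (2 * k + 1))).-1 = 2 * k
        & (2 * k + odd (n - 2 * k)).-1 = 2 * k].
    by move: odd_n; split; lia.
  rewrite D1 D2 D0 !pairs !Pset_up1 // !mul0n !add0n; split; first congr (_ + _);
    apply: eq_big_nat => k /parity[le1 le2 k1 k2];
    by rewrite ?subsets_from_parity ?subsets_below_parity // k1 k2 (subn1 n) mulnDl.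
Qed.
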